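(* Let $\theta=(k_r)$ be a lacunary sequence and let $q_r=k_r/k_{r-1}$. If $\limsup_{r} q_r<\infty$, then $AC_{\theta}\subseteq AC_{\sigma_1}$.
   Context: Let $w$ be the space of all sequences $x=(x_k)_{k\in\mathbb{N}}$ of complex numbers. For integers $m,n$, $\langle m,n\rangle$ denotes the greatest common divisor of $m$ and $n$. A lacunary sequence is an increasing sequence of integers $\theta=(k_r)_{r\ge 0}$, with $k_0\neq 0$, such that $h_r=k_r-k_{r-1}\to\infty$ as $r\to\infty$; put $I_r=(k_{r-1},k_r]$ and $q_r=k_r/k_{r-1}$ for $r\ge 1$ (the indices $m\in I_r$ below are natural numbers). Define $$AC_{\theta}=\left\{(x_m)\in w:\ \lim_{r\to\infty}\frac{1}{h_r}\sum_{m\in I_r}\left|x_m-x_{\langle m,n\rangle}\right|=0\ \text{for some integer } n\right\},$$ $$AC_{\sigma_1}=\left\{(x_m)\in w:\ \text{there exists an integer } n \text{ such that } \frac{1}{t}\sum_{m=1}^{t}\left|x_m-x_{\langle m,n\rangle}\right|\to 0\ \text{as } t\to\infty\right\}.$$ *)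

(* Defs.v *)
From HB Require Import structures.
From mathcomp Require Import all_boot all_order all_algebra.
From mathcomp Require Import all_classical all_reals all_analysis.
From mathcomp Require Import complex.
Set Implicit Arguments.
Unset Strict Implicit.
Unset Printing Implicit Defensive.
Import Order.TTheory GRing.Theory Num.Theory.
Import numFieldNormedType.Exports.
Local Open Scope classical_set_scope.
Local Open Scope ring_scope.

(* [Normc.normc z] is the modulus of [z : R[i]] as an element of R. *)

(* [lac_h], [lac_I] and [lac_q] are meant for r >= 1; the extra term at r = 0
   (where r.-1 = 0) does not affect the limits and the limsup taken below. *)
Definition lac_h (k : nat -> int) (r : nat) : int := k r - k r.-1.

Definition lac_I (k : nat -> int) (r : nat) : interval int := `]k r.-1, k r].

Definition lac_q (R : realType) (k : nat -> int) (r : nat) : R :=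
  (k r)%:~R / (k r.-1)%:~R.

Definition lacunary (R : realType) (k : nat -> int) : Prop :=
  [/\ increasing_seq k, k 0%N != 0 &
      ((lac_h k r)%:~R : R) @[r --> \oo] --> +oo].

Definition gcd_dev (R : realType) (x : nat -> R[i]) (n : int) (m : nat) : R :=
  Normc.normc (x m - x (gcdn m `|n|%N)).

(* Complex sequences are indexed by m >= 1, so the value [x 0] is never read
   (gcdn m _ > 0 for m > 0).  In [AC_theta] the sum runs over the natural
   numbers m >= 1 in I_r; the bound m <= `|k r| is implied by m <= k r.

   N is the set of moduli n allowed in "for some integer n".  As
   gcdn m 0 = m, a set N containing 0 makes both spaces contain every
   sequence, so the case of interest is [nonzero_int]. *)
Definition AC_theta (R : realType) (N : set int) (k : nat -> int) :
    set (nat -> R[i]) :=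
  [set x | exists2 n : int, N n &
    (((lac_h k r)%:~R)^-1 *
       \sum_(1 <= m < `|k r|%N.+1 | m%:Z \in lac_I k r) gcd_dev x n m)
      @[r --> \oo] --> (0 : R)].

Definition AC_sigma1 (R : realType) (N : set int) : set (nat -> R[i]) :=
  [set x | exists2 n : int, N n &
    ((t%:R)^-1 * \sum_(1 <= m < t.+1) gcd_dev x n m)
      @[t --> \oo] --> (0 : R)].

Definition nonzero_int : set int := [set n | n != 0].

Arguments AC_theta R N k : clear implicits.
Arguments AC_sigma1 R N : clear implicits.

(* Main.v *)
Require Import Defs.
From HB Require Import structures.
From mathcomp Require Import all_boot all_order all_algebra.
From mathcomp Require Import all_classical all_reals all_analysis.
From mathcomp Require Import complex.
From mathcomp Require Import zify lra.
Import Order.TTheory GRing.Theory Num.Theory.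
Import numFieldNormedType.Exports.
Local Open Scope classical_set_scope.
Local Open Scope ring_scope.

(* Write [S t] for the sum of the deviations up to [t].  If the block averages
   over [I_r] are at most [e] from some index [N] on, summing over blocks gives
   [S (k r) <= S (k N) + e * k r].  For [k r < t <= k r.+1] monotonicity and
   [k r.+1 <= M * k r] yield [S t <= S (k N) + e * M * t]; dividing by [t]
   makes the constant [S (k N)] negligible. *)

(** The upper limit is an infimum of suprema over the sets in the filter at infinity, so if it is
    below [+oo] then some such set [A] already has supremum below [+oo]. *)
Lemma limn_esup_lty_bounded (R : realType) (u : nat -> R) :
  (limn_esup (fun r => (u r)%:E) < +oo)%E ->
  exists2 M : R, 0 < M & \forall r \near \oo, u r <= M.
Proof.
move=> /ereal_inf_lt[_ [A Aoo <-] supA].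
have ubA r : A r -> ((u r)%:E <= ereal_sup [set (u r)%:E | r in A])%E.
  by move=> Ar; apply: ereal_sup_ubound; exists r.
move: supA ubA; case: (ereal_sup _) => [s|//|] _ ubA.
(* The summand 1 makes the bound strictly positive, as needed to divide by it later. *)
- exists (`|s| + 1); first by rewrite ltr_wpDl.
  apply: filterS Aoo => r /ubA; rewrite lee_fin => /le_trans; apply.
  by rewrite (le_trans (ler_norm s))// lerDl.
(* A supremum [-oo] would put a real number below [-oo], so the inequality holds vacuously. *)
- exists 1 => //; apply: filterS Aoo => r /ubA.
  by rewrite leeNy_eq.
Qed.

Lemma increasing_seq_int_ge (k : nat -> int) (r : nat) :
  increasing_seq k -> k 0%N + r%:Z <= k r.
Proof.
move=> k_inc; elim: r => [|r IHr]; first by rewrite addr0.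
have : k r < k r.+1 by rewrite (leW_mono k_inc) ltEnat /=.
lia.
Qed.

Lemma sum_lac_I (V : nmodType) (k : nat -> int) (f : nat -> V) (r : nat) :
  0 <= k r -> k r <= k r.+1 ->
  \sum_(1 <= m < `|k r.+1|%N.+1) f m =
  \sum_(1 <= m < `|k r|%N.+1) f m +
  \sum_(1 <= m < `|k r.+1|%N.+1 | m%:Z \in lac_I k r.+1) f m.
Proof.
move=> kr0 krS; have le_kr : (`|k r| <= `|k r.+1|)%N by lia.
rewrite (big_cat_nat (n := `|k r|%N.+1))//=; congr (_ + _).
rewrite (big_nat_widenl _ 1)// big_nat_cond [RHS]big_nat_cond.
apply: eq_bigl => m; rewrite /lac_I /= in_itv /=; lia.
Qed.

(** The block hypotheses are indexed by [r.+1] so that the predecessor in [lac_h], [lac_I] and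
    [lac_q] reduces to [r]. *)
Lemma lacunary_sum_le {R : realType} {k : nat -> int} {f : nat -> R}
    {N : nat} {M e : R} {t : nat} :
  increasing_seq k -> (forall m, 0 <= f m) -> 0 <= e ->
  (forall r, (N <= r)%N -> 0 < k r) ->
  (forall r, (N <= r)%N -> lac_q R k r.+1 <= M) ->
  (forall r, (N <= r)%N ->
    ((lac_h k r.+1)%:~R)^-1 *
      \sum_(1 <= m < `|k r.+1|%N.+1 | m%:Z \in lac_I k r.+1) f m <= e) ->
  k N < t%:Z ->
  \sum_(1 <= m < t.+1) f m <=
    \sum_(1 <= m < `|k N|%N.+1) f m + e * M * t%:R.
Proof.
move=> k_inc f0 e0 k_gt0 qM block kNt.
have k_lt a b : (k a < k b) = (a < b)%N by rewrite (leW_mono k_inc).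
set S := fun t : nat => \sum_(1 <= m < t.+1) f m.
rewrite -/(S t) -/(S `|k N|%N).
have S_le a b : (a <= b)%N -> S a <= S b.
  move=> ab; rewrite /S [leRHS](big_cat_nat (n := a.+1))//= lerDl.
  exact: sumr_ge0.
have S_k r : (N <= r)%N -> S `|k r|%N <= S `|k N|%N + e * (k r)%:~R.
  have base : S `|k N|%N <= S `|k N|%N + e * (k N)%:~R.
    by rewrite lerDl mulr_ge0// ler0z ltW// k_gt0.
  elim: r => [|r IHr]; first by rewrite leqn0 => /eqP <-.
  rewrite leq_eqVlt => /predU1P[<-//|].
  rewrite ltnS => Nr.
  have krS : k r < k r.+1 by rewrite k_lt.
  rewrite /S (sum_lac_I _ _ _ _ (ltW (k_gt0 r Nr)) (ltW krS)).
  have h0 : 0 < (lac_h k r.+1)%:~R :> R by rewrite ltr0z subr_gt0.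
  have := block r Nr; rewrite ler_pdivrMl// => block_r.
  have := IHr Nr; rewrite /S => IH.
  apply: le_trans (lerD IH block_r) _.
  (* The error terms telescope: [e * k r + e * (k r.+1 - k r) = e * k r.+1]. *)
  rewrite /lac_h /= rmorphB /=; lra.
have exr : exists r, t%:Z <= k r.
  exists (t + `|k 0%N|)%N.
  by have := increasing_seq_int_ge k (t + `|k 0%N|)%N k_inc; lia.
(* The least index with [t <= k r] locates the block of [t]. It cannot be 0, since [k N < t <= k 0]
   would force [N < 0]. *)
case: (ex_minnP exr) => -[|r] tr rmin.
  by have := lt_le_trans kNt tr; rewrite k_lt.
have krt : k r < t%:Z.
  by rewrite ltNge; apply/negP => /rmin; rewrite ltnn.
have Nr : (N <= r)%N by rewrite -ltnS -k_lt (lt_le_trans kNt tr).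
have kr0 : 0 < (k r)%:~R :> R by rewrite ltr0z k_gt0.
have kSM : (k r.+1)%:~R <= M * (k r)%:~R.
  by have := qM r Nr; rewrite /lac_q ler_pdivrMr.
have krS0 : 0 < (k r.+1)%:~R :> R by rewrite ltr0z k_gt0// leqW.
have M0 : 0 <= M by rewrite -(pmulr_lge0 _ kr0) (le_trans (ltW krS0)).
have t_le : (t <= `|k r.+1|)%N by lia.
apply: (le_trans (S_le _ _ t_le)); apply: (le_trans (S_k _ (leqW Nr))).
rewrite lerD2l -mulrA ler_wpM2l//; apply: (le_trans kSM).
by rewrite ler_wpM2l// -[t%:R]/((t%:Z)%:~R) ler_int ltW.
Qed.

(** The modulus [n] enters only through [f], so the same [n] witnesses membership in both spaces. *)
Lemma lacunary_cesaro_cvg0 {R : realType} {k : nat -> int} {f : nat -> R} :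
  increasing_seq k -> (forall m, 0 <= f m) ->
  (limn_esup (fun r => (lac_q R k r)%:E) < +oo)%E ->
  (((lac_h k r)%:~R)^-1 *
     \sum_(1 <= m < `|k r|%N.+1 | m%:Z \in lac_I k r) f m)
    @[r --> \oo] --> (0 : R) ->
  ((t%:R)^-1 * \sum_(1 <= m < t.+1) f m) @[t --> \oo] --> (0 : R).
Proof.
move=> k_inc f0 /limn_esup_lty_bounded[M M0 [N1 _ qM]] block.
apply/cvgr0Pnorm_le => e e0.
(* The factor [M] lost inside a block cancels this division, leaving [e / 2] for the blocks and
   [e / 2] for the constant [C]. *)
have d0 : 0 < e / 2 / M by rewrite !divr_gt0.
have [N2 _ block_le] := cvgr0_norm_le _ block _ d0.
(* As [k 0] may be negative, the first entry uses [k 0 + r <= k r] to make [k r] positive from [N]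
   on. *)
pose N := maxn `|k 0%N|.+1 (maxn N1 N2).
have k_gt0 r : (N <= r)%N -> 0 < k r.
  rewrite !geq_max => /and3P[Nr _ _].
  by have := increasing_seq_int_ge k r k_inc; lia.
pose C := \sum_(1 <= m < `|k N|%N.+1) f m.
near=> t.
have t0 : 0 < t%:R :> R by rewrite ltr0n; near: t; exact: nbhs_infty_gt.
have kNt : k N < t%:Z.
  have : (`|k N| < t)%N by near: t; exact: nbhs_infty_gt.
  by lia.
have Ct : C / (e / 2) <= t%:R by near: t; exact: nbhs_infty_ger.
have S0 : 0 <= \sum_(1 <= m < t.+1) f m by exact: sumr_ge0.
rewrite ger0_norm ?mulr_ge0 ?invr_ge0 ?(ltW t0)// ler_pdivrMl//.
have qMN r : (N <= r)%N -> lac_q R k r.+1 <= M.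
  by rewrite !geq_max => /and3P[_ Nr _]; apply: qM; exact: leqW.
have blockN r : (N <= r)%N -> ((lac_h k r.+1)%:~R)^-1 *
    \sum_(1 <= m < `|k r.+1|%N.+1 | m%:Z \in lac_I k r.+1) f m <= e / 2 / M.
  rewrite !geq_max => /and3P[_ _ Nr]; apply: le_trans (ler_norm _) _.
  by apply: block_le; exact: leqW.
apply: le_trans (lacunary_sum_le k_inc f0 (ltW d0) k_gt0 qMN blockN kNt) _.
rewrite divfK ?gt_eqF// -/C.
by move: Ct; rewrite ler_pdivrMr ?divr_gt0// => Ct; lra.
Unshelve. all: by end_near.
Qed.

(* The first inclusion reads "for some integer n" literally, the second one
   excludes the degenerate modulus n = 0. *)
Theorem theorem2p7 (R : realType) (k : nat -> int) :
  lacunary R k ->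
  (limn_esup (fun r => (lac_q R k r)%:E) < +oo)%E ->
  AC_theta R setT k `<=` AC_sigma1 R setT /\
  AC_theta R nonzero_int k `<=` AC_sigma1 R nonzero_int.
Proof.
move=> [k_inc _ _] q_bounded.
have dev_ge0 (x : nat -> R[i]) n m : 0 <= gcd_dev x n m.
  by rewrite /gcd_dev; case: (_ - _) => a b; exact: sqrtr_ge0.
by split=> x [n Nn x_theta]; exists n => //;
  exact: lacunary_cesaro_cvg0 k_inc (dev_ge0 x n) q_bounded x_theta.
Qed.
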